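(* Let $p$ be a prime and let $\beta\in\mathbb{Q}_p$ be a Pisot-Chabauty number. Then $$\mathrm{Per}(\beta)=\mathbb{Q}(\beta)\cap\mathbb{Z}_p .$$
   Context: Let $p$ be a prime, $\mathbb{Z}_p\subset\mathbb{Q}_p$ the $p$-adic integers and $p$-adic numbers, $|\cdot|_p$ the $p$-adic absolute value with $|p|_p=p^{-1}$, extended uniquely to algebraic extensions of $\mathbb{Q}_p$, and $|\cdot|_\infty$ the usual absolute value on $\mathbb{C}$. Put $\mathbb{A}_p:=\mathbb{Z}[\tfrac1p]=\{mp^n:m,n\in\mathbb{Z}\}\subset\mathbb{Q}\subset\mathbb{Q}_p$. Algebraic integers over $\mathbb{A}_p$: an element $\alpha$ is an algebraic integer over $\mathbb{A}_p$ if it is a root of a monic polynomial irreducible over $\mathbb{A}_p$ with coefficients in $\mathbb{A}_p$, called its minimal polynomial. If $n$ is its degree, the non-archimedean conjugates $\alpha_1=\alpha,\alpha_2,\dots,\alpha_n$ of $\alpha$ are the roots of the minimal polynomial in an algebraic closure of $\mathbb{Q}_p$, and the archimedean conjugates $\alpha_{n+1},\dots,\alpha_{2n}$ are its roots in $\mathbb{C}$. Pisot-Chabauty (PC) number: a number $\alpha\in\mathbb{Q}_p$ such that (i) $\alpha_1:=\alpha$ is an algebraic integer over $\mathbb{A}_p$; (ii) $|\alpha_1|_p>1$; (iii) $|\alpha_i|_p\le 1$ for all other non-archimedean conjugates, $i=2,\dots,n$; (iv) $|\alpha_i|_\infty<1$ for all archimedean conjugates, $i=n+1,\dots,2n$.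 Integer and fractional part: each $x\in\mathbb{Q}_p$ is uniquely $x=\sum_{i\ge n_0}x_ip^i$ with $x_i\in\{0,\dots,p-1\}$; put $\lfloor x\rfloor_p:=\sum_{i\ge0}x_ip^i\in\mathbb{Z}_p$ and $\{x\}_p:=\sum_{i<0}x_ip^i\in\mathbb{A}_p\cap[0,1)$. Beta-expansion: for $\beta\in\mathbb{Q}_p$ with $|\beta|_p>1$ let $T:\mathbb{Z}_p\to\mathbb{Z}_p$, $T(x)=\lfloor\beta x\rfloor_p$. For $\alpha\in\mathbb{Z}_p$ the beta-expansion $d_\beta(\alpha)$ is the sequence $(d_k)_{k\ge1}$ with $d_k=\{\beta T^{k-1}(\alpha)\}_p$. $\mathrm{Per}(\beta)$ is the set of $\alpha\in\mathbb{Z}_p$ for which $d_\beta(\alpha)$ is eventually periodic. *)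

(* Defs.v *)
From HB Require Import structures.
From mathcomp Require Import all_boot all_order all_algebra.
From mathcomp Require Import ring lra zify.
From mathcomp Require Import boolp classical_sets functions reals.
From mathcomp Require Import complex.

Set Implicit Arguments.
Unset Strict Implicit.
Unset Printing Implicit Defensive.

Import Order.TTheory GRing.Theory Num.Theory.
Local Open Scope ring_scope.
Local Open Scope quotient_scope.

(* The p-adic field is the completion of rat: the ring of Cauchy sequences of *)
(* rationals for the p-adic absolute value, modulo the ideal of null          *)
(* sequences. Its absolute value only takes the values 0 and p ^ k, k : int,  *)
(* hence it is rational-valued.                                               *)

Section RatNorm.

Variable p : nat.

(* |x|_p = p ^ (v_p (denominator) - v_p (numerator)).                         *)
Definition ratpnorm (x : rat) : rat :=
  if x == 0 then 0
  else (p%:R : rat) ^ ((logn p `|denq x|)%:Z - (logn p `|numq x|)%:Z).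

Lemma ratpnorm0 : ratpnorm 0 = 0.
Proof. by rewrite /ratpnorm eqxx. Qed.

Hypothesis p_pr : prime p.

Let p_gt0 : 0 < p%:R :> rat.
Proof. by rewrite ltr0n prime_gt0. Qed.

Let p_neq0 : p%:R != 0 :> rat.
Proof. by rewrite gt_eqF. Qed.

Lemma ratpnorm_gt0 x : x != 0 -> 0 < ratpnorm x.
Proof. by rewrite /ratpnorm => /negPf ->; exact: exprz_gt0. Qed.

Lemma ratpnorm_ge0 x : 0 <= ratpnorm x.
Proof.
by have [->|/ratpnorm_gt0/ltW//] := eqVneq x 0; rewrite ratpnorm0.
Qed.

Lemma ratpnorm_eq0 x : (ratpnorm x == 0) = (x == 0).
Proof.
by have [->|/ratpnorm_gt0/gt_eqF//] := eqVneq x 0; rewrite ratpnorm0 eqxx.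
Qed.

Lemma ratpnorm_frac (n d : int) : n != 0 -> d != 0 ->
  ratpnorm (n%:~R / d%:~R) = (p%:R : rat) ^ ((logn p `|d|)%:Z - (logn p `|n|)%:Z).
Proof.
move=> n0 d0; set x : rat := n%:~R / d%:~R.
have x0 : x != 0 by rewrite mulf_neq0 ?invr_eq0 ?intr_eq0.
have E : n * denq x = numq x * d.
  apply/eqP; rewrite -(eqr_int rat) !rmorphM /= numqE mulrAC.
  by rewrite /x mulfVK // intr_eq0.
have : (logn p `|n| + logn p `|denq x| = logn p `|numq x| + logn p `|d|)%N.
  by rewrite -!lognM ?absz_gt0 ?numq_eq0 ?denq_eq0 // -!abszM E.
rewrite /ratpnorm (negPf x0) => H; congr (_ ^ _); lia.
Qed.

Lemma ratpnorm1 : ratpnorm 1 = 1.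
Proof.
have := @ratpnorm_frac 1 1 isT isT.
by rewrite divr1 => ->; rewrite subrr.
Qed.

Lemma ratpnormM (x y : rat) : ratpnorm (x * y) = ratpnorm x * ratpnorm y.
Proof.
have [->|x0] := eqVneq x 0; first by rewrite mul0r ratpnorm0 mul0r.
have [->|y0] := eqVneq y 0; first by rewrite mulr0 ratpnorm0 mulr0.
rewrite -[x in LHS]divq_num_den -[y in LHS]divq_num_den mulf_div -!rmorphM /=.
rewrite ratpnorm_frac ?mulf_neq0 ?numq_eq0 ?denq_eq0 //.
rewrite /ratpnorm (negPf x0) (negPf y0) -expfzDr // !abszM.
rewrite !lognM ?absz_gt0 ?numq_eq0 ?denq_eq0 //.
by congr (_ ^ _); rewrite !PoszD opprD addrACA.
Qed.

Lemma ratpnormV x : ratpnorm x^-1 = (ratpnorm x)^-1.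
Proof.
have [->|x0] := eqVneq x 0; first by rewrite !(invr0, ratpnorm0).
apply: (mulfI (_ : ratpnorm x != 0)); first by rewrite ratpnorm_eq0.
by rewrite -ratpnormM divff // divff ?ratpnorm_eq0 // ratpnorm1.
Qed.

Lemma ratpnormN x : ratpnorm (- x) = ratpnorm x.
Proof. by rewrite /ratpnorm oppr_eq0 numqN denqN abszN. Qed.

Lemma ratpnormBC (x y : rat) : ratpnorm (x - y) = ratpnorm (y - x).
Proof. by rewrite -ratpnormN opprB. Qed.

Lemma ratpnorm_p : ratpnorm p%:R = p%:R^-1.
Proof.
have := @ratpnorm_frac p%:Z 1; rewrite divr1 => -> //; last first.
  by rewrite -lt0n prime_gt0.
by rewrite /= logn1 logn_prime // eqxx sub0r exprN1.
Qed.

Lemma ratpnorm_int_le1 (n : int) : ratpnorm n%:~R <= 1.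
Proof.
have [->|n0] := eqVneq n 0; first by rewrite ratpnorm0.
have := @ratpnorm_frac n 1 n0 isT; rewrite divr1 => ->.
rewrite /= logn1 sub0r -exprz_inv -exprnP.
by rewrite exprn_ile1 ?invr_ge0 ?ler0n // invf_le1 // ler1n prime_gt0.
Qed.

Lemma ratpnorm_coprime (n : int) : ~~ (p %| `|n|)%N -> ratpnorm n%:~R = 1.
Proof.
move=> pn; have n0 : n != 0 by apply: contraNneq pn => ->; rewrite dvdn0.
have := ratpnorm_frac n0 (isT : 1 != 0 :> int); rewrite divr1 => ->.
rewrite logn1 sub0r; suff -> : logn p `|n| = 0%N by rewrite oppr0 expr0z.
by apply/eqP; rewrite eqn0Ngt logn_gt0 mem_primes (negPf pn) !andbF.
Qed.

Lemma ratpnorm_le1_den z : z != 0 -> ratpnorm z <= 1 -> ~~ (p %| `|denq z|)%N.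
Proof.
move=> z0 zle; apply/negP => pd; have := zle; rewrite /ratpnorm (negPf z0).
have -> : logn p `|numq z| = 0%N.
  apply/eqP; rewrite eqn0Ngt logn_gt0 mem_primes p_pr absz_gt0 numq_eq0 z0 /=.
  apply/negP => pn; have := coprime_num_den z.
  rewrite /coprime => /eqP g1.
  have : (p %| gcdn `|numq z| `|denq z|)%N by rewrite dvdn_gcd pn.
  by rewrite g1 dvdn1 => /eqP p1; move: p_pr; rewrite p1.
have lg : (0 < logn p `|denq z|)%N.
  by rewrite logn_gt0 mem_primes p_pr absz_gt0 denq_eq0 pd.
rewrite subr0 -exprnP leNgt exprn_egt1 ?ltr1n ?prime_gt1 //.
by rewrite -lt0n lg.
Qed.

Lemma ratpnorm_dvd (n : int) : (p %| `|n|)%N = (ratpnorm n%:~R <= p%:R^-1).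
Proof.
apply/idP/idP => [pn|]; last first.
  apply: contraTT => /ratpnorm_coprime ->; rewrite -ltNge invf_lt1 //.
  by rewrite ltr1n prime_gt1.
have /dvdzP[k ->] : (p%:Z %| n)%Z by rewrite dvdzE.
rewrite rmorphM /= ratpnormM ratpnorm_p ler_piMl ?invr_ge0 ?ler0n //.
exact: ratpnorm_int_le1.
Qed.

Lemma ratpnorm_digit (a : rat) : ratpnorm a <= 1 ->
  exists2 c : nat, (c < p)%N & ratpnorm (a - c%:R) <= p%:R^-1.
Proof.
have [->|a0] := eqVneq a 0.
  by exists 0%N; rewrite ?prime_gt0 // subr0 ratpnorm0 invr_ge0 ltW.
move=> /(ratpnorm_le1_den a0) dp; set t := denq a.
have /coprimezP[[k l] /= kl] : coprimez t p%:Z.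
  by rewrite coprimezE coprime_sym prime_coprime.
have pZ : (p%:Z != 0) by rewrite -lt0n prime_gt0.
have := modz_ge0 (numq a * k) pZ; have := ltz_pmod (numq a * k) (_ : 0 < p%:Z).
case E : (numq a * k %% p)%Z => [c|//] cp _; exists c.
  by have := cp; apply; rewrite ltz_nat prime_gt0.
have -> : a - c%:R = (numq a - c%:Z * t)%:~R / t%:~R.
  rewrite rmorphB rmorphM /= mulrBl mulfK ?intr_eq0 ?denq_eq0 //.
  by rewrite divq_num_den.
rewrite ratpnormM ratpnormV (ratpnorm_coprime dp) invr1 mulr1 -ratpnorm_dvd.
have -> : numq a - c%:Z * t = (numq a * l + (numq a * k %/ p%:Z)%Z * t) * p%:Z.
  have := divz_eq (numq a * k) p%:Z; rewrite E => H.
  move: (numq a * k %/ p%:Z)%Z H => q H.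
  have -> : c%:Z = numq a * k - q * p%:Z by rewrite H; ring.
  by rewrite -{1}[numq a]mulr1 -kl /t; ring.
by rewrite abszM dvdn_mull.
Qed.

Lemma ratpnormX (x : rat) (i : int) : ratpnorm (x ^ i) = ratpnorm x ^ i.
Proof.
have nat_case k : ratpnorm (x ^+ k) = ratpnorm x ^+ k.
  by elim: k => [|k IH]; rewrite ?ratpnorm1 // !exprS ratpnormM IH.
by case: i => k; rewrite ?NegzE -?invr_expz -?exprnP ?nat_case ?ratpnormV ?nat_case.
Qed.

Lemma ratpnormD (x y : rat) : ratpnorm (x + y) <= Num.max (ratpnorm x) (ratpnorm y).
Proof.
have [->|x0] := eqVneq x 0; first by rewrite add0r le_max lexx orbT.
have [->|y0] := eqVneq y 0; first by rewrite addr0 le_max lexx.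
have [->|xy0] := eqVneq (x + y) 0.
  by rewrite ratpnorm0 le_max ratpnorm_ge0.
wlog le_yx : x y x0 y0 xy0 / ratpnorm y <= ratpnorm x.
  move=> W; have /orP[H|H] := le_total (ratpnorm y) (ratpnorm x).
    exact: W.
  by rewrite addrC maxC; apply: W; rewrite // addrC.
rewrite le_max; apply/orP; left.
have H : ratpnorm (1 + y / x) <= 1; last first.
  have -> : x + y = x * (1 + y / x) by field.
  by rewrite ratpnormM ler_piMr // ratpnorm_ge0.
have {le_yx} : ratpnorm (y / x) <= 1.
  by rewrite ratpnormM ratpnormV ler_pdivrMr ?mul1r ?ratpnorm_gt0.
set z := y / x; have z0 : z != 0 by rewrite mulf_neq0 ?invr_eq0.
move=> /(ratpnorm_le1_den z0) dz.
have -> : 1 + z = (denq z + numq z)%:~R / (denq z)%:~R.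
  by rewrite rmorphD /= mulrDl divff ?intr_eq0 ?denq_eq0 // divq_num_den.
rewrite ratpnormM -[leRHS]mul1r; apply: ler_pM; rewrite ?ratpnorm_ge0 //.
  exact: ratpnorm_int_le1.
by rewrite ratpnormV ratpnorm_coprime // invr1.
Qed.

Lemma ratpnormD_lt (x y e : rat) : ratpnorm x < e -> ratpnorm y < e -> ratpnorm (x + y) < e.
Proof.
by move=> xe ye; apply: le_lt_trans (ratpnormD x y) _; rewrite gt_max xe.
Qed.

Lemma ratpnorm_eq (x y : rat) : ratpnorm (x - y) < ratpnorm y -> ratpnorm x = ratpnorm y.
Proof.
move=> H; apply/eqP; rewrite eq_le; apply/andP; split.
  rewrite -{1}(subrK y x).
  by apply: le_trans (ratpnormD _ _) _; rewrite ge_max lexx ltW.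
rewrite leNgt; apply/negP => K.
by rewrite ratpnormBC in H; have := ratpnormD_lt H K; rewrite subrK ltxx.
Qed.

End RatNorm.

Section PadicNumbers.

Variables (p : nat) (p_pr : prime p).
Local Notation rnorm := (ratpnorm p).

Definition is_cauchy (u : nat -> rat) : bool :=
  `[< forall e : rat, 0 < e -> exists N : nat, forall m n : nat,
        (N <= m)%N -> (N <= n)%N -> rnorm (u m - u n) < e >].

Definition is_null (u : nat -> rat) : bool :=
  `[< forall e : rat, 0 < e -> exists N : nat, forall n : nat,
        (N <= n)%N -> rnorm (u n) < e >].

Lemma is_cauchyP u : reflect (forall e : rat, 0 < e -> exists N : nat,
    forall m n : nat, (N <= m)%N -> (N <= n)%N -> rnorm (u m - u n) < e)
  (is_cauchy u).
Proof. exact: asboolP. Qed.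

Lemma is_nullP u : reflect (forall e : rat, 0 < e -> exists N : nat,
    forall n : nat, (N <= n)%N -> rnorm (u n) < e) (is_null u).
Proof. exact: asboolP. Qed.

Lemma cauchy_bounded u : is_cauchy u ->
  exists B N : _, 0 < B /\ forall n : nat, (N <= n)%N -> rnorm (u n) < B.
Proof.
move=> /is_cauchyP/(_ 1 ltr01)[N HN]; exists (rnorm (u N) + 1), N; split.
  by rewrite ltr_wpDl ?ratpnorm_ge0.
move=> n Nn; rewrite -[u n](subrK (u N)); apply: ratpnormD_lt => //.
  by rewrite ltr_wpDl ?ratpnorm_ge0 // HN.
by rewrite ltrDl.
Qed.

Lemma is_null_mul u v : is_cauchy u -> is_null v -> is_null (u * v).
Proof.
move=> /cauchy_bounded[B [N [B0 HN]]] /is_nullP cv; apply/is_nullP => e e0.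
have [M HM] := cv _ (divr_gt0 e0 B0); exists (maxn N M) => n.
rewrite geq_max => /andP[Nn Mn]; rewrite ratpnormM //.
rewrite -[e](divfK (lt0r_neq0 B0)) mulrC.
by apply: ltr_pM; rewrite ?ratpnorm_ge0 ?HM ?HN.
Qed.

Lemma is_cauchy_subring : subring_closed is_cauchy.
Proof.
split.
- by apply/is_cauchyP => e e0; exists 0%N => m n _ _; rewrite subrr ratpnorm0.
- move=> u v /is_cauchyP cu /is_cauchyP cv; apply/is_cauchyP => e e0.
  have [[N HN] [M HM]] := (cu e e0, cv e e0); exists (maxn N M) => m n.
  rewrite !geq_max => /andP[Nm Mm] /andP[Nn Mn].
  have -> : (u - v) m - (u - v) n = (u m - u n) + (v n - v m).
    by change (u m - v m - (u n - v n) = u m - u n + (v n - v m)); ring.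
  by apply: ratpnormD_lt; rewrite ?HN ?HM.
- move=> u v cu cv.
  have [B [N [B0 HN]]] := cauchy_bounded cu.
  have [C [M [C0 HM]]] := cauchy_bounded cv.
  move/is_cauchyP: cu => cu; move/is_cauchyP: cv => cv.
  apply/is_cauchyP => e e0.
  have [N' HN'] := cu _ (divr_gt0 e0 C0).
  have [M' HM'] := cv _ (divr_gt0 e0 B0).
  exists (maxn (maxn N M) (maxn N' M')) => m n.
  rewrite !geq_max => /andP[/andP[Nm Mm] /andP[N'm M'm]].
  move=> /andP[/andP[Nn Mn] /andP[N'n M'n]].
  have -> : (u * v) m - (u * v) n = (u m - u n) * v m + u n * (v m - v n).
    change (u m * v m - u n * v n = (u m - u n) * v m + u n * (v m - v n)).
    by ring.
  apply: ratpnormD_lt => //; rewrite ratpnormM //.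
    rewrite -[e](divfK (lt0r_neq0 C0)).
    by apply: ltr_pM; rewrite ?ratpnorm_ge0 ?HM ?HN'.
  rewrite -[e](divfK (lt0r_neq0 B0)) mulrC.
  by apply: ltr_pM; rewrite ?ratpnorm_ge0 ?HM' ?HN.
Qed.

HB.instance Definition _ :=
  GRing.isSubringClosed.Build (nat -> rat) is_cauchy is_cauchy_subring.

Definition cauchy_seq := {u : nat -> rat | is_cauchy u}.

HB.instance Definition _ := Choice.on cauchy_seq.
HB.instance Definition _ := SubChoice.on cauchy_seq.
HB.instance Definition _ := [SubChoice_isSubComNzRing of cauchy_seq by <:].

Definition null_ideal : {pred cauchy_seq} := [pred u | is_null (val u)].

Lemma null_ideal_closed : idealr_closed null_ideal.
Proof.
split.
- by apply/is_nullP => e e0; exists 0%N => n _; rewrite /= ratpnorm0.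
- apply/negP => /is_nullP/(_ 1 ltr01)[N /(_ N (leqnn N))].
  by rewrite rmorph1 /= ratpnorm1 // ltxx.
- move=> a u v un vn; apply/is_nullP => e e0.
  have /is_nullP/(_ e e0)[N HN] : is_null (val a * val u).
    by apply: is_null_mul => //; exact: valP.
  move/is_nullP: vn => /(_ e e0)[M HM]; exists (maxn N M) => n.
  rewrite geq_max => /andP[Nn Mn]; rewrite rmorphD rmorphM /=.
  by apply: ratpnormD_lt; rewrite ?HM //; apply: HN.
Qed.

HB.instance Definition _ :=
  isIdealr.Build cauchy_seq null_ideal null_ideal_closed.

Definition padic := {ideal_quot null_ideal}.

HB.instance Definition _ := GRing.ComNzRing.on padic.

Definition padic_of_cauchy (u : cauchy_seq) : padic := \pi_{ideal_quot null_ideal} u.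

Lemma padic_of_cauchy_monoid_morphism : monoid_morphism padic_of_cauchy.
Proof.
by split; [exact: (rmorph1 \pi_{ideal_quot null_ideal})
          |exact: (rmorphM \pi_{ideal_quot null_ideal})].
Qed.

Lemma padic_of_cauchy_zmod_morphism : zmod_morphism padic_of_cauchy.
Proof. exact: (rmorphB \pi_{ideal_quot null_ideal}). Qed.

HB.instance Definition _ := GRing.isZmodMorphism.Build _ _ padic_of_cauchy
  padic_of_cauchy_zmod_morphism.
HB.instance Definition _ := GRing.isMonoidMorphism.Build _ _ padic_of_cauchy
  padic_of_cauchy_monoid_morphism.

Definition cauchy_of_padic (x : padic) : cauchy_seq :=
  @repr _ {ideal_quot null_ideal} x.

Lemma cauchy_of_padicK : cancel cauchy_of_padic padic_of_cauchy.
Proof. by move=> x; rewrite /padic_of_cauchy reprK. Qed.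

Lemma padic_of_cauchy_eq u v :
  (padic_of_cauchy u == padic_of_cauchy v) = is_null (val (u - v)).
Proof. by rewrite -[RHS]/(u - v \in null_ideal) Quotient.idealrBE. Qed.

Lemma padic_of_cauchy_eq0 u : (padic_of_cauchy u == 0) = is_null (val u).
Proof. by rewrite -(rmorph0 padic_of_cauchy) padic_of_cauchy_eq subr0. Qed.

Lemma padicP (x : padic) : exists u, x = padic_of_cauchy u.
Proof. by exists (cauchy_of_padic x); rewrite cauchy_of_padicK. Qed.

Lemma cauchy_norm_stable u : is_cauchy u -> ~~ is_null u ->
  exists N : nat, u N != 0 /\ forall n : nat, (N <= n)%N -> rnorm (u n) = rnorm (u N).
Proof.
move=> /is_cauchyP cu /is_nullP/existsNP[e] /not_implyP[e0 /forallNP eN].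
have [N HN] := cu e e0.
have /existsNP[n /not_implyP[Nn /negP]] := eN N; rewrite -leNgt => en.
exists n; split; first by rewrite -(ratpnorm_eq0 p_pr) gt_eqF // (lt_le_trans e0).
move=> m nm; apply: ratpnorm_eq => //.
by apply: lt_le_trans en; apply: HN => //; exact: leq_trans nm.
Qed.

Lemma is_cauchy_inv u : is_cauchy u -> ~~ is_null u ->
  is_cauchy (fun n => (u n)^-1).
Proof.
move=> cu nu; have [N [uN HN]] := cauchy_norm_stable cu nu.
have c0 : 0 < rnorm (u N) by apply: ratpnorm_gt0.
move/is_cauchyP: cu => cu; apply/is_cauchyP => e e0.
have [M HM] := cu _ (mulr_gt0 e0 (mulr_gt0 c0 c0)).
have un0 n : (N <= n)%N -> u n != 0.
  by move=> Nn; rewrite -(ratpnorm_eq0 p_pr) HN // gt_eqF.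
exists (maxn N M) => m n; rewrite !geq_max => /andP[Nm Mm] /andP[Nn Mn].
have -> : (u m)^-1 - (u n)^-1 = (u n - u m) / (u m * u n).
  by field; rewrite !un0.
by rewrite ratpnormM // ratpnormV // ratpnormM // !HN // ltr_pdivrMr ?mulr_gt0 ?HM.
Qed.

Definition padic_inv (x : padic) : padic :=
  if x == 0 then 0
  else padic_of_cauchy (insubd 0 (fun n => (val (cauchy_of_padic x) n)^-1)).

Lemma padic_mulVf x : x != 0 -> padic_inv x * x = 1.
Proof.
move=> x0; rewrite /padic_inv (negPf x0).
have := cauchy_of_padicK x; move: (cauchy_of_padic x) => u xE.
have nu : ~~ is_null (val u) by rewrite -padic_of_cauchy_eq0 xE.
have cu := valP u; rewrite -{}xE -rmorphM -(rmorph1 padic_of_cauchy).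
apply/eqP; rewrite padic_of_cauchy_eq; apply/is_nullP => e e0.
have [N [uN HN]] := cauchy_norm_stable cu nu; exists N => n Nn.
rewrite rmorphB rmorphM rmorph1 /= insubdK; last exact: is_cauchy_inv.
have un0 : val u n != 0.
  by rewrite -(ratpnorm_eq0 p_pr) HN // ratpnorm_eq0.
change (rnorm ((val u n)^-1 * val u n - 1) < e).
by rewrite mulVf // subrr ratpnorm0.
Qed.

Lemma padic_invr0 : padic_inv 0 = 0.
Proof. by rewrite /padic_inv eqxx. Qed.

HB.instance Definition _ :=
  GRing.ComNzRing_isField.Build padic padic_mulVf padic_invr0.

Lemma is_cauchy_cst (a : rat) : is_cauchy (fun=> a).
Proof.
by apply/is_cauchyP => e e0; exists 0%N => m n _ _; rewrite subrr ratpnorm0.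
Qed.

Definition padic_of_rat (a : rat) : padic :=
  padic_of_cauchy (Sub (fun=> a) (is_cauchy_cst a)).

Lemma padic_of_rat_zmod_morphism : zmod_morphism padic_of_rat.
Proof.
move=> a b; rewrite /padic_of_rat -rmorphB; congr padic_of_cauchy.
by apply: val_inj; rewrite rmorphB.
Qed.

Lemma padic_of_rat_monoid_morphism : monoid_morphism padic_of_rat.
Proof.
split=> [|a b]; rewrite /padic_of_rat -1?(rmorph1 padic_of_cauchy) -1?rmorphM;
  congr padic_of_cauchy; apply: val_inj.
  by rewrite rmorph1.
by rewrite rmorphM.
Qed.

HB.instance Definition _ := GRing.isZmodMorphism.Build _ _ padic_of_rat
  padic_of_rat_zmod_morphism.
HB.instance Definition _ := GRing.isMonoidMorphism.Build _ _ padic_of_rat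
  padic_of_rat_monoid_morphism.

(* If x != 0, then |u n|_p is eventually constant for any u representing x;   *)
(* that constant is |x|_p.                                                    *)
Definition padic_norm (x : padic) : rat :=
  if x == 0 then 0
  else xget 0 [set c | exists N : nat, forall n : nat, (N <= n)%N ->
                 rnorm (val (cauchy_of_padic x) n) = c].

Lemma padic_norm0 : padic_norm 0 = 0.
Proof. by rewrite /padic_norm eqxx. Qed.

Lemma padic_norm_cauchy u : padic_of_cauchy u != 0 ->
  exists N : nat, forall n : nat, (N <= n)%N ->
    rnorm (val u n) = padic_norm (padic_of_cauchy u) /\ val u n != 0.
Proof.
move=> u0; have nu : ~~ is_null (val u) by rewrite -padic_of_cauchy_eq0.
rewrite /padic_norm (negPf u0); set x := padic_of_cauchy u.
set v := cauchy_of_padic x.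
have vE : padic_of_cauchy v = x by rewrite cauchy_of_padicK.
have [N [uN HN]] := cauchy_norm_stable (valP u) nu.
have /eqP := vE; rewrite padic_of_cauchy_eq => /is_nullP/(_ _ (ratpnorm_gt0 p_pr uN)).
case=> M HM.
have vn n : (maxn N M <= n)%N -> rnorm (val v n) = rnorm (val u N).
  rewrite geq_max => /andP[Nn Mn]; rewrite -(HN n Nn); apply: ratpnorm_eq => //.
  by rewrite HN //; have := HM n Mn; rewrite rmorphB.
case: xgetP => [c _ [K HK]|/(_ (rnorm (val u N)))]; last first.
  by case; exists (maxn N M).
have <- : rnorm (val u N) = c.
  rewrite -(HK (maxn K (maxn N M)) (leq_maxl _ _)) vn //.
  exact: leq_maxr.
exists N => n Nn; split; first exact: HN.
by rewrite -(ratpnorm_eq0 p_pr) HN // ratpnorm_eq0.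
Qed.

Lemma padic_norm_ge0 x : 0 <= padic_norm x.
Proof.
have [->|] := eqVneq x 0; first by rewrite padic_norm0.
have [u ->] := padicP x => /padic_norm_cauchy[N /(_ N (leqnn N))[<- _]].
exact: ratpnorm_ge0.
Qed.

Lemma padic_norm_eq0 x : (padic_norm x == 0) = (x == 0).
Proof.
have [->|] := eqVneq x 0; first by rewrite padic_norm0 eqxx.
have [u ->] := padicP x => /padic_norm_cauchy[N /(_ N (leqnn N))[<- uN]].
by rewrite ratpnorm_eq0 // (negPf uN).
Qed.

Lemma padic_norm_rat a : padic_norm (padic_of_rat a) = rnorm a.
Proof.
have [->|a0] := eqVneq a 0; first by rewrite rmorph0 padic_norm0 ratpnorm0.
have : padic_of_rat a != 0 by rewrite fmorph_eq0.
by move=> /padic_norm_cauchy[N /(_ N (leqnn N))[<- _]].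
Qed.

Lemma padic_normM x y : padic_norm (x * y) = padic_norm x * padic_norm y.
Proof.
have [->|] := eqVneq x 0; first by rewrite mul0r padic_norm0 mul0r.
have [->|] := eqVneq y 0; first by rewrite mulr0 padic_norm0 mulr0.
have [u ->] := padicP x; have [v ->] := padicP y => v0 u0.
have := mulf_neq0 u0 v0; rewrite -rmorphM => /padic_norm_cauchy[N HN].
have [[M HM] [K HK]] := (padic_norm_cauchy u0, padic_norm_cauchy v0).
pose n := maxn N (maxn M K).
have /HN[<- _] : (N <= n)%N by exact: leq_maxl.
have /HM[<- _] : (M <= n)%N by rewrite !leq_max leqnn !orbT.
have /HK[<- _] : (K <= n)%N by rewrite !leq_max leqnn !orbT.
by rewrite rmorphM -ratpnormM.
Qed.

Lemma padic_normD x y :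
  padic_norm (x + y) <= Num.max (padic_norm x) (padic_norm y).
Proof.
have [->|] := eqVneq x 0; first by rewrite add0r le_max lexx orbT.
have [->|] := eqVneq y 0; first by rewrite addr0 le_max lexx.
have [->|] := eqVneq (x + y) 0; first by rewrite padic_norm0 le_max padic_norm_ge0.
have [u ->] := padicP x; have [v ->] := padicP y.
rewrite -rmorphD => /padic_norm_cauchy[N HN].
move=> /padic_norm_cauchy[K HK] /padic_norm_cauchy[M HM].
pose n := maxn N (maxn M K).
have /HN[<- _] : (N <= n)%N by exact: leq_maxl.
have /HM[<- _] : (M <= n)%N by rewrite !leq_max leqnn !orbT.
have /HK[<- _] : (K <= n)%N by rewrite !leq_max leqnn !orbT.
by rewrite rmorphD; apply: ratpnormD.
Qed.

Lemma padic_normN x : padic_norm (- x) = padic_norm x.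
Proof.
rewrite -mulN1r padic_normM -(rmorph1 padic_of_rat) -rmorphN padic_norm_rat.
by rewrite ratpnormN ratpnorm1 // mul1r.
Qed.

Lemma padic_of_rat_dense x (e : rat) : 0 < e ->
  exists a : rat, padic_norm (x - padic_of_rat a) < e.
Proof.
move=> e0; have [u xE] := padicP x; have /is_cauchyP/(_ e e0)[N HN] := valP u.
exists (val u N).
have [->|] := eqVneq (x - padic_of_rat (val u N)) 0; first by rewrite padic_norm0.
rewrite xE /padic_of_rat -rmorphB => /padic_norm_cauchy[M].
move=> /(_ (maxn N M) (leq_maxr _ _))[<- _].
by rewrite rmorphB; apply: HN => //; exact: leq_maxl.
Qed.

Definition padic_cvg (u : nat -> padic) (l : padic) : Prop :=
  forall e : rat, 0 < e ->
    exists N : nat, forall n : nat, (N <= n)%N -> padic_norm (u n - l) < e.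

Lemma padic_cvg_unique u l m : padic_cvg u l -> padic_cvg u m -> l = m.
Proof.
move=> ul um; apply/eqP; rewrite -subr_eq0 -padic_norm_eq0; apply: contraT => lm.
have e0 : 0 < padic_norm (l - m) by rewrite lt_def lm padic_norm_ge0.
have [[N HN] [M HM]] := (ul _ e0, um _ e0); pose n := maxn N M.
have := padic_normD (l - u n) (u n - m); rewrite leNgt => /negP[].
rewrite addrA subrK gt_max HM ?leq_maxr // andbT.
by rewrite -padic_normN opprB HN ?leq_maxl.
Qed.

Lemma padic_complete (u : nat -> padic) :
  (forall e : rat, 0 < e -> exists N : nat, forall m n : nat,
     (N <= m)%N -> (N <= n)%N -> padic_norm (u m - u n) < e) ->
  exists l, padic_cvg u l.
Proof.
move=> cu.
have d0 n : 0 < n.+1%:R^-1 :> rat by rewrite invr_gt0 ltr0n.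
have [a aP] : {a : nat -> rat |
    forall n, padic_norm (u n - padic_of_rat (a n)) < n.+1%:R^-1}.
  exists (fun n => sval (cid (padic_of_rat_dense (u n) (d0 n)))) => n.
  exact: (svalP (cid (padic_of_rat_dense (u n) (d0 n)))).
have small (e : rat) : 0 < e -> exists N : nat, forall n : nat, (N <= n)%N ->
    padic_norm (u n - padic_of_rat (a n)) < e.
  move=> e0; exists (Num.truncn e^-1) => n Nn; apply: lt_trans (aP n) _.
  rewrite invf_plt ?posrE ?ltr0n //; apply: lt_le_trans (truncnS_gt _) _.
  by rewrite ler_nat.
have ca : is_cauchy a.
  apply/is_cauchyP => e e0; have [[N HN] [M HM]] := (cu e e0, small e e0).
  exists (maxn N M) => m n; rewrite !geq_max => /andP[Nm Mm] /andP[Nn Mn].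
  rewrite -padic_norm_rat rmorphB.
  have -> : padic_of_rat (a m) - padic_of_rat (a n) =
    (padic_of_rat (a m) - u m) + ((u m - u n) + (u n - padic_of_rat (a n))).
    by ring.
  apply: le_lt_trans (padic_normD _ _) _; rewrite gt_max.
  rewrite -padic_normN opprB HM //=.
  by apply: le_lt_trans (padic_normD _ _) _; rewrite gt_max HM // HN.
exists (padic_of_cauchy (Sub a ca)) => e e0.
have /is_cauchyP/(_ e e0)[N HN] := ca; have [M HM] := small e e0.
exists (maxn N M) => n; rewrite geq_max => /andP[Nn Mn].
rewrite -[u n](subrK (padic_of_rat (a n))) -addrA.
apply: le_lt_trans (padic_normD _ _) _; rewrite gt_max HM //=.
set y := _ - _; have [->|] := eqVneq y 0; first by rewrite padic_norm0.
rewrite /y /padic_of_rat -rmorphB => /padic_norm_cauchy[K].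
move=> /(_ (maxn n K) (leq_maxr _ _))[<- _].
rewrite rmorphB; apply: HN => //.
by apply: leq_trans Nn _; exact: leq_maxl.
Qed.

(* \sum_(n0 <= i < n0 + N) (d i) p ^ i, for a digit sequence d indexed by int. *)
Definition digit_sum (d : int -> nat) (n0 : int) (N : nat) : rat :=
  \sum_(j < N) (d (n0 + j%:Z))%:R * p%:R ^ (n0 + j%:Z).

Definition padic_digits_of (x : padic) (n0 : int) (d : int -> nat) : Prop :=
  [/\ forall i, (d i < p)%N,
      forall i, i < n0 -> d i = 0%N
    & padic_cvg (fun N : nat => padic_of_rat (digit_sum d n0 N)) x].

Let p_gt0 : 0 < p%:R :> rat.
Proof. by rewrite ltr0n prime_gt0. Qed.

Let p_neq0 : p%:R != 0 :> rat.
Proof. by rewrite gt_eqF. Qed.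

Let pV_lt1 : p%:R^-1 < 1 :> rat.
Proof. by rewrite invf_lt1 // ltr1n prime_gt1. Qed.

Lemma exprVp_lt (e : rat) : 0 < e -> exists N : nat, p%:R^-1 ^+ N < e.
Proof.
move=> e0; exists (Num.truncn e^-1).+1; rewrite exprVn.
rewrite invf_plt ?posrE ?exprn_gt0 //; apply: lt_trans (truncnS_gt _) _.
by rewrite -natrX ltr_nat ltn_expl // prime_gt1.
Qed.

Lemma padic_digit_near y : padic_norm y <= 1 ->
  exists2 c : nat, (c < p)%N & padic_norm (y - padic_of_rat c%:R) <= p%:R^-1.
Proof.
move=> y1; have [|a ya] := @padic_of_rat_dense y p%:R^-1; first by rewrite invr_gt0.
have [|c cp ac] := @ratpnorm_digit _ p_pr a.
  rewrite -padic_norm_rat -[padic_of_rat a](subrK y).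
  apply: le_trans (padic_normD _ _) _; rewrite ge_max y1 andbT.
  by rewrite -padic_normN opprB (ltW (lt_trans ya _)).
exists c => //; rewrite -[y](subrK (padic_of_rat a)) -addrA -rmorphB.
by apply: le_trans (padic_normD _ _) _; rewrite ge_max (ltW ya) padic_norm_rat.
Qed.

Lemma padic_digits_exist x : exists nd : int * (int -> nat),
  padic_digits_of x nd.1 nd.2.
Proof.
have [c cP] : {c : padic -> nat | forall y, padic_norm y <= 1 ->
    (c y < p)%N /\ padic_norm (y - padic_of_rat (c y)%:R) <= p%:R^-1}.
  apply: cid; have : forall y, exists c, padic_norm y <= 1 ->
      (c < p)%N /\ padic_norm (y - padic_of_rat c%:R) <= p%:R^-1.
    move=> y; have [y1|] := boolP (padic_norm y <= 1); last by exists 0%N.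
    by have [k] := padic_digit_near y1; exists k.
  by move=> /choice[c cP]; exists c.
have [n xn] : exists n : nat, padic_norm (x * padic_of_rat (p%:R ^+ n)) <= 1.
  have x1 : 0 < padic_norm x + 1 by rewrite ltr_wpDl ?padic_norm_ge0.
  have [|n Hn] := @exprVp_lt (padic_norm x + 1)^-1; first by rewrite invr_gt0.
  exists n; rewrite padic_normM padic_norm_rat.
  rewrite (@ratpnormX _ p_pr _ n%:Z) ratpnorm_p //.
  apply: (@le_trans _ _ ((padic_norm x + 1) * (padic_norm x + 1)^-1)).
    apply: ler_pM; rewrite ?padic_norm_ge0 ?lerDl ?(ltW Hn) //.
    by rewrite exprz_ge0 // invr_ge0 ltW.
  by rewrite divff // gt_eqF.
pose y (k : nat) : padic := iter k (fun y : padic => (y - padic_of_rat (c y)%:R) / padic_of_rat p%:R)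
  (x * padic_of_rat (p%:R ^+ n)).
have y1 k : padic_norm (y k) <= 1.
  elim: k => [|k IH] //; have [_ H] := cP _ IH.
  rewrite /y iterS -/(y k) padic_normM -fmorphV padic_norm_rat ratpnormV //.
  by rewrite ratpnorm_p // invrK -ler_pdivlMr // mul1r.
pose d (i : int) : nat := if i < - n%:Z then 0%N else c (y (absz (i + n%:Z))).
exists (- n%:Z, d); split => [i|i /= ni|e e0] /=.
- by rewrite /d; case: ifP => _; [rewrite prime_gt0|exact: (cP _ (y1 _)).1].
- by rewrite /d ni.
have E N : x - padic_of_rat (digit_sum d (- n%:Z) N) =
    padic_of_rat (p%:R ^ (N%:Z - n%:Z)) * y N.
  elim: N => [|N IH].
    rewrite /digit_sum big_ord0 rmorph0 subr0 /y /= mulrCA -rmorphM sub0r exprnP.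
    by rewrite -expfzDr // addNr rmorph1 mulr1.
  rewrite /digit_sum big_ord_recr rmorphD /= opprD addrA IH.
  have -> : d (- n%:Z + N%:Z) = c (y N).
    by rewrite /d ltNge lerDl /= addrC addrA subrr add0r.
  have -> : N.+1%:Z - n%:Z = (N%:Z - n%:Z) + 1 by lia.
  rewrite [p%:R ^ (_ + 1)]expfzDr // expr1z [- n%:Z + _]addrC !rmorphM /=.
  rewrite -[RHS]mulrA [padic_of_rat p%:R * _]mulrC divfK ?fmorph_eq0 //.
  by rewrite mulrBr; congr (_ - _); exact: mulrC.
have [M HM] := @exprVp_lt (e / p%:R ^+ n) (divr_gt0 e0 (exprn_gt0 n p_gt0)).
exists M => N MN; rewrite -padic_normN opprB E padic_normM padic_norm_rat.
rewrite ratpnormX // ratpnorm_p // -[e]mulr1.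
apply: (@le_lt_trans _ _ (p%:R^-1 ^ (N%:Z - n%:Z) * 1)).
  by apply: ler_wpM2l; rewrite // exprz_ge0 // invr_ge0 ltW.
rewrite !mulr1 expfzDr ?invr_eq0 //.
have -> : p%:R^-1 ^ (- n%:Z) = p%:R ^+ n :> rat by rewrite exprz_inv opprK.
rewrite -ltr_pdivlMr ?exprn_gt0 //; apply: le_lt_trans HM.
by rewrite -exprnP ler_wiXn2l ?invr_ge0 ?ltW.
Qed.

Lemma digit_sum_cat d n0 M N :
  digit_sum d n0 (M + N) = digit_sum d n0 M + digit_sum d (n0 + M%:Z) N.
Proof.
rewrite /digit_sum big_split_ord /=; congr (_ + _).
by apply: eq_bigr => j _; rewrite PoszD addrA.
Qed.

Lemma digit_sum_norm d n0 N : rnorm (digit_sum d n0 N) <= p%:R^-1 ^ n0.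
Proof.
rewrite /digit_sum; elim/big_ind : _ => [|a b Ha Hb|j _].
- by rewrite ratpnorm0 exprz_ge0 // invr_ge0 ltW.
- by apply: le_trans (ratpnormD p_pr a b) _; rewrite ge_max Ha.
rewrite ratpnormM // ratpnormX // ratpnorm_p // expfzDr ?invr_eq0 //.
have q0 : 0 <= p%:R^-1 :> rat by rewrite invr_ge0 ltW.
rewrite mulrCA ler_piMr ?exprz_ge0 //.
rewrite mulr_ile1 ?ratpnorm_ge0 ?exprz_ge0 //.
  exact: (@ratpnorm_int_le1 _ p_pr (d _)).
by rewrite -exprnP exprn_ile1 // ltW.
Qed.

Lemma padic_digits_of_shift x n0 d b : padic_digits_of x n0 d -> b <= n0 ->
  padic_digits_of x b d.
Proof.
move=> [dp d0 dx] bn; split => // [i ib|e e0]; first by rewrite d0 // (lt_le_trans ib).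
have [N HN] := dx e e0; have [k kE] : exists k : nat, n0 = b + k%:Z.
  by exists (absz (n0 - b)); lia.
exists (N + k)%N => m Nm.
have km : (k <= m)%N by apply: leq_trans Nm; exact: leq_addl.
rewrite -(subnKC km) digit_sum_cat -kE {1}/digit_sum big1 ?add0r.
  by apply: HN; rewrite leq_subRL // addnC.
move=> j _; rewrite d0 ?mul0r // kE.
by have := ltn_ord j; lia.
Qed.

Lemma padic_digits_of_tail x n0 d k : padic_digits_of x n0 d ->
  padic_norm (x - padic_of_rat (digit_sum d n0 k)) <= p%:R^-1 ^ (n0 + k%:Z).
Proof.
move=> [_ _ dx].
have [|N HN] := dx (p%:R^-1 ^ (n0 + k%:Z)); first by rewrite exprz_gt0 // invr_gt0.
pose m := (k + N)%N; rewrite -[x](subrK (padic_of_rat (digit_sum d n0 m))).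
rewrite -addrA -rmorphB; apply: le_trans (padic_normD _ _) _; rewrite ge_max.
rewrite -padic_normN opprB (ltW (HN _ _)) ?leq_addl //=.
by rewrite padic_norm_rat /m digit_sum_cat addrC addKr digit_sum_norm.
Qed.

Lemma padic_digits_of_unique x n0 d n1 e :
  padic_digits_of x n0 d -> padic_digits_of x n1 e -> d =1 e.
Proof.
move=> dx ex; pose b := Num.min n0 n1.
have {dx ex} [dx ex] : padic_digits_of x b d /\ padic_digits_of x b e.
  by split; [apply: padic_digits_of_shift dx _|apply: padic_digits_of_shift ex _];
    rewrite ge_min lexx ?orbT.
have [[dp d0 _] [ep e0 _]] := (dx, ex).
suff H k : d (b + k%:Z) = e (b + k%:Z).
  move=> i; have [ib|bi] := ltP i b; first by rewrite d0 ?e0.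
  have -> : i = b + (absz (i - b))%:Z by lia.
  exact: H.
have [m km] := ubnP k; elim: m k km => // m IH k km.
have sumE : digit_sum d b k = digit_sum e b k.
  apply: eq_bigr => j _; rewrite IH //; apply: leq_trans (ltn_ord j) _.
  by rewrite -ltnS.
have := padic_digits_of_tail k.+1 ex; have := padic_digits_of_tail k.+1 dx.
rewrite -addn1 !digit_sum_cat -sumE /digit_sum !big_ord1 addr0.
move: (\sum_(j < k) _) => s; set i := b + k%:Z => Hd He.
set u : int := (d i)%:Z - (e i)%:Z.
have : rnorm (u%:~R * p%:R ^ i) <= p%:R^-1 ^ (i + 1).
  rewrite -padic_norm_rat.
  have -> : u%:~R * p%:R ^ i =
      (s + (d i)%:R * p%:R ^ i) - (s + (e i)%:R * p%:R ^ i) :> rat.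
    by rewrite /u rmorphB /= mulrBl opprD addrACA subrr add0r.
  rewrite rmorphB /=; set S := padic_of_rat _; set S' := padic_of_rat _.
  have -> : S - S' = (x - S') + - (x - S).
    by rewrite opprB [RHS]addrC addrA subrK.
  apply: le_trans (padic_normD _ _) _; rewrite ge_max padic_normN.
  by move: Hd He; rewrite PoszD addrA => -> ->.
rewrite ratpnormM // ratpnormX // ratpnorm_p //.
rewrite [_ ^ (i + 1)]expfzDr ?invr_eq0 // expr1z mulrC ler_pM2l ?exprz_gt0 ?invr_gt0 // -ratpnorm_dvd //.
move=> pu; have /eqP : u == 0.
  rewrite -absz_eq0; apply: contraTT pu => u0.
  apply/negP => /dvdn_leq; rewrite lt0n => /(_ u0).
  by have := dp i; have := ep i; rewrite /u; lia.
by rewrite /u; lia.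
Qed.

(* The start n0 of the expansion is a choice, but the digits are not, by      *)
(* padic_digits_of_unique; as the digits of index less than n0 are 0, what    *)
(* follows does not depend on n0.                                             *)
Definition padic_expansion (x : padic) : int * (int -> nat) :=
  sval (cid (padic_digits_exist x)).

Definition padic_digit (x : padic) (i : int) : nat := (padic_expansion x).2 i.

Lemma padic_digitP x :
  padic_digits_of x (padic_expansion x).1 (padic_digit x).
Proof. exact: svalP (cid (padic_digits_exist x)). Qed.

Definition padic_lim (u : nat -> padic) : padic := xget 0 [set l | padic_cvg u l].

Lemma padic_cvg_lim u l : padic_cvg u l -> padic_lim u = l.
Proof.
move=> ul; rewrite /padic_lim; case: xgetP => [m _ um|/(_ l)//].
exact: padic_cvg_unique um ul.
Qed.

(* \sum_(i >= 0) x_i p ^ i.                                                   *)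
Definition padic_intpart (x : padic) : padic :=
  padic_lim (fun N => padic_of_rat (digit_sum (padic_digit x) 0 N)).

(* \sum_(i < 0) x_i p ^ i, as a rational number; the x_i with i < - |n0| are 0. *)
Definition padic_fracpart (x : padic) : rat :=
  let n := absz (padic_expansion x).1 in digit_sum (padic_digit x) (- n%:Z) n.

Lemma padic_intpart_cvg x :
  padic_cvg (fun N => padic_of_rat (digit_sum (padic_digit x) 0 N))
    (x - padic_of_rat (padic_fracpart x)).
Proof.
have := padic_digitP x; set n0 := (padic_expansion x).1 => dx e e0.
have [|_ _ /(_ e e0)[N HN]] := @padic_digits_of_shift _ _ _ (- (absz n0)%:Z) dx.
  by lia.
exists N => m Nm; have := HN (absz n0 + m)%N (leq_trans Nm (leq_addl _ _)).
rewrite digit_sum_cat addNr -/(padic_fracpart x) rmorphD /=.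
by rewrite opprB addrCA addrA.
Qed.

Lemma padic_intpartE x : padic_intpart x = x - padic_of_rat (padic_fracpart x).
Proof. exact/padic_cvg_lim/padic_intpart_cvg. Qed.

Lemma padic_intpart_norm x : padic_norm (padic_intpart x) <= 1.
Proof.
have := padic_digitP x; set n0 := (padic_expansion x).1 => dx.
have [|dp d0 dx'] := @padic_digits_of_shift _ _ _ (- (absz n0)%:Z) dx.
  by lia.
rewrite padic_intpartE.
have := padic_digits_of_tail (absz n0) (And3 dp d0 dx').
by rewrite addNr expr0z.
Qed.

Lemma padic_fracpart_bounds x : 0 <= padic_fracpart x < 1.
Proof.
have [dp _ _] := padic_digitP x; rewrite /padic_fracpart.
move: (absz _) => n; set d := padic_digit x; apply/andP; split.
  by apply: sumr_ge0 => j _; rewrite mulr_ge0 // exprz_ge0 // ltW.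
have H b k : digit_sum d b k <= p%:R ^ (b + k%:Z) - p%:R ^ b.
  elim: k => [|k IH]; first by rewrite /digit_sum big_ord0 addr0 subrr.
  rewrite -addn1 digit_sum_cat {2}/digit_sum big_ord1 addr0 PoszD addrA.
  apply: le_trans (lerD IH (lexx _)) _; rewrite [leLHS]addrAC lerD2r.
  rewrite [leRHS]expfzDr // expr1z -[X in X + _]mul1r -mulrDl mulrC.
  by rewrite ler_pM2l ?exprz_gt0 // nat1r ler_nat.
apply: le_lt_trans (H _ _) _; rewrite addNr expr0z ltrBlDr ltrDl.
by rewrite exprz_gt0.
Qed.

Definition padic_int : set padic := [set x | padic_norm x <= 1].

(* Z[1/p] as a set of rationals; m and n range over the integers.             *)
Definition zinvp : set rat :=
  [set x | exists m n : int, x = m%:~R * p%:R ^ n].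

Definition over_zinvp (f : {poly rat}) : Prop := forall i : nat, zinvp f`_i.

(* Units and irreducible elements of the ring Z[1/p][X], whose elements are   *)
(* the f : {poly rat} such that over_zinvp f. Irreducibility is not taken     *)
(* over the field rat.                                                        *)
Definition unit_zinvp (f : {poly rat}) : Prop :=
  over_zinvp f /\ exists g, over_zinvp g /\ f * g = 1.

Definition irreducible_zinvp (f : {poly rat}) : Prop :=
  [/\ over_zinvp f, f != 0, ~ unit_zinvp f &
      forall g h : {poly rat}, over_zinvp g -> over_zinvp h -> f = g * h ->
        unit_zinvp g \/ unit_zinvp h].

Definition min_poly_zinvp (a : padic) (m : {poly rat}) : Prop :=
  [/\ m \is monic, irreducible_zinvp m & root (map_poly padic_of_rat m) a].

(* L, with iota and absL, is an algebraic closure of the p-adic field with an *)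
(* absolute value extending the p-adic one.                                   *)
Definition is_padic_closure (R : realType) (L : closedFieldType)
    (iota : {rmorphism padic -> L}) (absL : L -> R) : Prop :=
  (forall z, algebraicOver iota z) /\
  [/\ forall z, 0 <= absL z,
      forall z, absL z = 0 <-> z = 0,
      forall z w, absL (z * w) = absL z * absL w,
      forall z w, absL (z + w) <= Num.max (absL z) (absL w)
    & forall x, absL (iota x) = ratr (padic_norm x)].

(* The sequence s lists, with multiplicity, the non-archimedean conjugates    *)
(* other than a itself; the roots of m in R[i] are the archimedean ones.      *)
Definition pisot_chabauty (R : realType) (L : closedFieldType)
    (iota : {rmorphism padic -> L}) (absL : L -> R) (a : padic) : Prop :=
  exists m : {poly rat},
    [/\ min_poly_zinvp a m,
        1 < padic_norm a,
        exists s : seq L,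
          map_poly iota (map_poly padic_of_rat m) =
            \prod_(z <- iota a :: s) ('X - z%:P) /\
          forall z, z \in s -> absL z <= 1
      & forall z : R[i], root (map_poly ratr m) z -> `|z| < 1].

Definition beta_map (b x : padic) : padic := padic_intpart (b * x).

(* Meaningful for k >= 1 only: the first digit is the one of index 1.         *)
Definition beta_expansion (b a : padic) (k : nat) : rat :=
  padic_fracpart (b * iter k.-1 (beta_map b) a).

(* Here too the terms of d are those of index k >= 1.                         *)
Definition eventually_periodic (d : nat -> rat) : Prop :=
  exists N l : nat, (0 < l)%N /\ forall k : nat, (N < k)%N -> d (k + l)%N = d k.

Definition Per (b : padic) : set padic :=
  [set a | padic_int a /\ eventually_periodic (beta_expansion b a)].

(* The subfield Q(b).                                                         *)
Definition rat_adjoin (b : padic) : set padic :=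
  [set x | exists f g : {poly rat}, (map_poly padic_of_rat g).[b] != 0 /\
     x = (map_poly padic_of_rat f).[b] / (map_poly padic_of_rat g).[b]].

End PadicNumbers.

Arguments padic_int {p} p_pr.

(* Main.v *)
(* If d(x) and d(y) agree then T^n x - T^n y = beta^n (x - y) stays in Z_p,     *)
(* so x = y because |beta|_p > 1. Hence an eventually periodic expansion makes  *)
(* the T-orbit eventually periodic, which is a linear equation over Q(beta).    *)
(*                                                                              *)
(* Conversely, let m be the minimal polynomial of beta over Z[1/p] and let      *)
(* a = f(beta), f in Q[X]. Then T^k a = G_k(beta) for polynomials G_k of        *)
(* bounded degree with G_(k+1)(z) = z G_k(z) - d_(k+1) at every root z of m, in *)
(* C or in an algebraic closure of Q_p. As |z| < 1 in C, |z|_p <= 1 for z       *)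
(* other than beta, and G_k(beta) is in Z_p, the values G_k(z) are bounded. The *)
(* G_k have bounded denominators away from p because m is monic over Z[1/p].    *)
(* Interpolation at the roots needs them to be distinct, so the G_k are reduced *)
(* modulo the minimal polynomial M of beta over Q, which is separable and       *)
(* divides m; this avoids Gauss's lemma for Z[1/p]. The coefficients of the     *)
(* G_k mod M then range over a finite set, and the orbit is eventually periodic *)
(* by the pigeonhole principle.                                                 *)

Require Import Defs.
From mathcomp Require Import all_boot all_order all_algebra.
From mathcomp Require Import separable fieldext polyorder.
From mathcomp Require Import ring lra zify.
From mathcomp Require Import boolp classical_sets reals complex.

Set Implicit Arguments.
Unset Strict Implicit.
Unset Printing Implicit Defensive.

Import Order.TTheory GRing.Theory Num.Theory.
Local Open Scope ring_scope.

(** Multiplication by beta expands p-adically: [beta_expansion_inj] and [iter_beta_map_horner] turn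
    a periodic expansion into a linear equation, solved in [Per_sub_rat_adjoin]. The converse is a
    Northcott-type finiteness: rational polynomials of bounded degree that are bounded at every
    place are finite in number. [archimedean_orbit_coef_bounded] handles the real absolute value,
    [nonarchimedean_orbit_coef_bounded] the prime p, [over_zinvp_reduced_orbit] and
    [over_zinvp_modp] the other primes, and [zinvp_poly_recurrent] draws the repetition. *)

Section AbsoluteValue.

(** * Bounding coefficients by values at distinct points *)

Variables (F : fieldType) (R : realFieldType) (v : F -> R).

Definition absolute_value : Prop :=
  [/\ v 0 = 0, forall x, 0 <= v x, {morph v : x y / x * y}
    & forall x y, v (x + y) <= v x + v y].

Hypothesis v_abs : absolute_value.

Lemma absv_sum (I : Type) (r : seq I) (P : pred I) (f : I -> F) :
  v (\sum_(i <- r | P i) f i) <= \sum_(i <- r | P i) v (f i).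
Proof.
have [v0 _ _ vD] := v_abs.
elim/big_rec2: _ => [|i y x _ le_xy]; first by rewrite v0.
by apply: le_trans (vD _ _) _; rewrite lerD2l.
Qed.

(* The coefficients are recovered from the values by the inverse of the       *)
(* Vandermonde matrix of the points.                                          *)
Lemma coef_bounded (s : seq F) (B : F -> R) : uniq s ->
  exists C, forall f : {poly F}, (size f <= size s)%N ->
    (forall z, z \in s -> v f.[z] <= B z) -> forall i, v f`_i <= C.
Proof.
have [v0 v_ge0 vM _] := v_abs; move=> s_uniq.
pose n := size s; pose a : 'rV[F]_n := \row_j s`_j.
have V_unit : Vandermonde n a \in unitmx.
  rewrite unitmxE unitfE det_Vandermonde; apply/prodf_neq0 => i _.
  apply/prodf_neq0 => j ij; rewrite subr_eq0 !mxE nth_uniq //.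
  by apply: contraTneq ij => ->; rewrite ltnn.
pose W := invmx (Vandermonde n a).
(* Summing over all columns makes the constant independent of the coefficient index; [|B s_j|] keeps
   the terms nonnegative whatever the sign of [B]. *)
exists (\sum_(i < n) \sum_(j < n) `|B s`_j| * v (W j i)) => f sf fB i.
have terms_ge0 (k : 'I_n) : 0 <= \sum_(j < n) `|B s`_j| * v (W j k).
  by apply: sumr_ge0 => j _; rewrite mulr_ge0.
have [ni|iltn] := leqP n i.
  by rewrite nth_default ?v0 ?sumr_ge0 // (leq_trans sf).
have -> : f`_i = \sum_(j < n) f.[s`_j] * W j (Ordinal iltn).
  pose u : 'rV[F]_n := \row_j f`_j.
  have uV : u *m Vandermonde n a = \row_j f.[s`_j].
    apply/rowP => j; rewrite !mxE (horner_coef_wide _ sf).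
    by apply: eq_bigr => k _; rewrite !mxE.
  have /rowP/(_ (Ordinal iltn)) : u = \row_j f.[s`_j] *m W.
    by rewrite -uV mulmxK.
  by rewrite !mxE => ->; apply: eq_bigr => j _; rewrite mxE.
apply: le_trans (absv_sum _ _ _) _.
rewrite [leRHS](bigD1 (Ordinal iltn)) //= -[leLHS]addr0.
apply: lerD; last exact: sumr_ge0.
apply: ler_sum => j _; rewrite vM ler_wpM2r //.
by rewrite (le_trans (fB _ _)) ?mem_nth // ler_norm.
Qed.

End AbsoluteValue.

(** Separability gives as many distinct interpolation points as the degree of [M]. Stated for any
    closed field, so as to serve both C and the algebraic closure of Q_p. *)
Lemma coef_bounded_roots (R : realFieldType) (F : closedFieldType)
    (phi : {rmorphism rat -> F}) (v : F -> R) (M : {poly rat}) (B : F -> R) :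
  absolute_value v -> separable_poly M ->
  exists C, forall f : {poly rat}, (size f < size M)%N ->
    (forall z, root (map_poly phi M) z -> v (map_poly phi f).[z] <= B z) ->
    forall i, v (phi f`_i) <= C.
Proof.
move=> v_abs sepM; have M0 := separable_poly_neq0 sepM.
have [s sE] := closed_field_poly_normal (map_poly phi M).
have lc0 : lead_coef (map_poly phi M) != 0 by rewrite lead_coef_eq0 map_poly_eq0.
have s_uniq : uniq s.
  move: sepM; rewrite -(separable_map phi) -separable_prod_XsubC sE.
  by rewrite !unlock derivZ coprimepZl ?coprimepZr.
have rootM z : z \in s -> root (map_poly phi M) z.
  by rewrite sE rootZ // root_prod_XsubC.
have [C CP] := coef_bounded v_abs B s_uniq; exists C => f sf fB i.
rewrite -coef_map; apply: CP => [|z /rootM]; last exact: fB.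
rewrite size_map_poly -ltnS; apply: leq_trans sf _.
by rewrite -(size_map_poly phi) sE size_scale // size_prod_XsubC.
Qed.

(** * Minimal polynomials over a field *)

Lemma root_irreducible_poly (F K : fieldType) (phi : {rmorphism F -> K})
    (m : {poly F}) (x : K) : m != 0 -> root (map_poly phi m) x ->
  exists M, irreducible_poly M /\ root (map_poly phi M) x.
Proof.
move=> m0 mx.
pose P n := `[< exists f : {poly F},
  [/\ f != 0, root (map_poly phi f) x & size f = n] >].
have exP : exists n, P n by exists (size m); apply/asboolP; exists m.
case: (ex_minnP exP) => n /asboolP[M [M0 Mx Mn]] min_n.
exists M; split=> //; apply/(subfx_irreducibleP Mx M0) => q qx q0.
by rewrite Mn; apply: min_n; apply/asboolP; exists q.
Qed.

Section IrreducibleRoot.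

Variables (F K : fieldType) (phi : {rmorphism F -> K}) (M : {poly F}) (x : K).
Hypotheses (M_irr : irreducible_poly M) (Mx : root (map_poly phi M) x).

Lemma irreducible_root_coprime g : (map_poly phi g).[x] != 0 -> coprimep M g.
Proof.
rewrite irreducible_poly_coprime //; apply: contraNN => /dvdpP[q ->].
by rewrite rmorphM /= hornerM (eqP Mx) mulr0.
Qed.

Lemma irreducible_root_dvd g : root (map_poly phi g) x -> M %| g.
Proof.
move=> gx; apply: contraT; rewrite -irreducible_poly_coprime //.
move=> /Bezout_coprimepP[[u w]] /=; rewrite -size_poly_eq1.
rewrite -(size_map_poly phi) rmorphD !rmorphM /= => /size_poly1P[c c0].
move=> /(congr1 (horner^~ x)); rewrite hornerD !hornerM (eqP Mx) (eqP gx).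
by rewrite !mulr0 addr0 hornerC => /esym/eqP; rewrite (negPf c0).
Qed.

(** Turns a quotient of values at [x], hence any element of Q(beta), into the value of a single
    polynomial. *)
Lemma root_inverse g : (map_poly phi g).[x] != 0 ->
  exists u, (map_poly phi u).[x] * (map_poly phi g).[x] = 1.
Proof.
move=> gx; have /Bezout_eq1_coprimepP[[u w] /= uw] := irreducible_root_coprime gx.
exists w; have /(congr1 (fun h => (map_poly phi h).[x])) := uw.
rewrite rmorphD !rmorphM rmorph1 /= hornerD !hornerM hornerC.
by rewrite (eqP Mx) mulr0 add0r.
Qed.

End IrreducibleRoot.

(** In characteristic zero the derivative of [M] is nonzero and of smaller degree, so [M] cannot
    divide it. *)
Lemma irreducible_poly_separable (F : realFieldType) (M : {poly F}) :
  irreducible_poly M -> separable_poly M.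
Proof.
move=> M_irr; rewrite unlock irreducible_poly_coprime //.
apply/negP => /dvdp_leq M_le; have := M_irr.1.
rewrite -subn_gt0 subn1 -size_deriv size_poly_gt0 => /M_le; apply/negP.
by rewrite -ltnNge lt_size_deriv ?irredp_neq0.
Qed.

(** * Pigeonhole principle and finiteness over Z[1/p] *)

Lemma pigeonhole_eventually (T : finType) (f : nat -> T) :
  exists N l : nat, (0 < l)%N /\ f (N + l)%N = f N.
Proof.
have /injectivePn[i [j ij fij]] : ~~ injectiveb (fun i : 'I_#|T|.+1 => f i).
  by apply/negP => /injectiveP/leq_card; rewrite card_ord ltnn.
wlog lt_ij : i j ij fij / (i < j)%N.
  have [lt_ij|lt_ji|/val_inj eq_ij] := ltngtP i j.
  - by move/(_ i j ij fij lt_ij).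
  - by move/(_ j i); rewrite eq_sym; apply.
  - by rewrite eq_ij eqxx in ij.
exists i, (j - i)%N; split; first by rewrite subn_gt0.
by rewrite subnKC; [exact: esym fij|exact: ltnW].
Qed.

Section ZInvP.

Variables (p : nat) (p_pr : prime p).
Local Notation rnorm := (ratpnorm p).

Let p_gt0 : 0 < p%:R :> rat. Proof. by rewrite ltr0n prime_gt0. Qed.
Let p_neq0 : p%:R != 0 :> rat. Proof. by rewrite gt_eqF. Qed.

Lemma zinvpP x : zinvp p x <-> exists e : nat, x * p%:R ^+ e \is a Num.int.
Proof.
split=> [[m [n ->]]|[e /intrP[m xE]]]; last first.
  exists m, (- e%:Z); rewrite -exprnN -xE mulfK //.
  by rewrite expf_neq0.
exists (absz n); case: n => n /=.
  by rewrite -exprnP !rpredM ?rpredX ?rpred_nat ?intr_int.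
by rewrite NegzE -exprnN mulfVK ?expf_neq0 ?intr_int.
Qed.

Lemma zinvp_int x : x \is a Num.int -> zinvp p x.
Proof. by move=> xi; apply/zinvpP; exists 0%N; rewrite expr0 mulr1. Qed.

Lemma zinvpM x y : zinvp p x -> zinvp p y -> zinvp p (x * y).
Proof.
move=> /zinvpP[d xd] /zinvpP[e ye]; apply/zinvpP; exists (d + e)%N.
by rewrite exprD mulrACA rpredM.
Qed.

Lemma zinvpD x y : zinvp p x -> zinvp p y -> zinvp p (x + y).
Proof.
move=> /zinvpP[d xd] /zinvpP[e ye]; apply/zinvpP; exists (d + e)%N.
rewrite exprD mulrDl [in X in _ + X](mulrC (_ ^+ d)) !mulrA.
by rewrite rpredD // rpredM // rpredX // rpred_nat.
Qed.

Lemma zinvpN x : zinvp p x -> zinvp p (- x).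
Proof. by move=> xp; rewrite -mulN1r; apply: zinvpM; first exact: zinvp_int. Qed.

Lemma zinvp_sum (I : Type) (r : seq I) (P : pred I) (f : I -> rat) :
  (forall i, P i -> zinvp p (f i)) -> zinvp p (\sum_(i <- r | P i) f i).
Proof.
by move=> fP; elim/big_ind: _ => //; [exact: zinvp_int|exact: zinvpD].
Qed.

Lemma zinvp_norm_le1 x : zinvp p x -> rnorm x <= 1 -> x \is a Num.int.
Proof.
move=> /zinvpP[e]; elim: e => [|e IH]; first by rewrite expr0 mulr1.
move=> /intrP[n nE] x1; apply: IH => //.
have : rnorm n%:~R <= p%:R^-1.
  rewrite -nE ratpnormM // (ratpnormX p_pr _ e.+1%:Z) ratpnorm_p //.
  have pV_ge0 : 0 <= p%:R^-1 :> rat by rewrite invr_ge0 ltW.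
  rewrite -exprnP exprS mulrCA ler_piMr // mulr_ile1 ?ratpnorm_ge0 ?exprn_ge0 //.
  by rewrite exprn_ile1 // invf_le1 // ler1n prime_gt0.
rewrite -ratpnorm_dvd // => pn.
have /dvdzP[k nk] : (p%:Z %| n)%Z by rewrite dvdzE.
have -> : x * p%:R ^+ e = k%:~R; last exact: intr_int.
by apply: (mulIf p_neq0); rewrite -mulrA -exprSr nE nk rmorphM.
Qed.

Lemma zinvp_poly_recurrent (q B C : rat) (r : nat) (g : nat -> {poly rat}) :
    q != 0 -> (forall k, (size (g k) <= r)%N) ->
    (forall k, over_zinvp p (q *: g k)) ->
    (forall k i, rnorm (g k)`_i <= B) -> (forall k i, `|(g k)`_i| <= C) ->
  exists N l : nat, (0 < l)%N /\ g (N + l)%N = g N.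
Proof.
move=> q0 gr gz gB gC.
have pV_ge0 : 0 <= p%:R^-1 :> rat by rewrite invr_ge0 ltW.
have B_ge0 : 0 <= B by apply: le_trans (gB 0 0)%N; exact: ratpnorm_ge0.
(* Chosen so that p^e absorbs both |q|_p and [B]: the coefficients of [D *: g k] then have p-adic
   norm at most 1. The added 1 keeps the inverted quantity positive. *)
have [|e He] := @exprVp_lt _ p_pr (rnorm q * B + 1)^-1.
  by rewrite invr_gt0 ltr_wpDl // mulr_ge0 ?ratpnorm_ge0.
pose D := q * p%:R ^+ e; have D0 : D != 0 by rewrite mulf_neq0 ?expf_neq0.
have Dint k i : D * (g k)`_i \is a Num.int.
  apply: zinvp_norm_le1.
    rewrite /D mulrAC; apply: zinvpM; last first.
      by apply: zinvp_int; rewrite rpredX ?rpred_nat.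
    by have := gz k i; rewrite coefZ.
  rewrite !ratpnormM // (ratpnormX p_pr _ e%:Z) ratpnorm_p // -exprnP mulrAC.
  have X0 : 0 < rnorm q * B + 1 by rewrite ltr_wpDl // mulr_ge0 ?ratpnorm_ge0.
  rewrite -[leRHS](mulfV (lt0r_neq0 X0)); apply: ler_pM; rewrite ?(ltW He) //.
  - by rewrite mulr_ge0 ?ratpnorm_ge0.
  - exact: exprn_ge0.
  - by apply: ler_wpDr => //; rewrite ler_wpM2l ?ratpnorm_ge0.
pose c := Num.bound (`|D| * C).
have Dc k i : `|Num.floor (D * (g k)`_i)| < c%:Z.
  rewrite -(ltr_int rat) intr_norm floorK ?Dint // normrM.
  apply: le_lt_trans (archi_boundP _); first by rewrite ler_wpM2l.
  by rewrite mulr_ge0 //; apply: le_trans (gC 0 0)%N.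
(* Adding [c] moves the integers of absolute value below [c] into the naturals below [c + c], a
   finite type. *)
pose F k := [ffun i : 'I_r =>
  inord (absz (Num.floor (D * (g k)`_i) + c%:Z)) : 'I_(c + c).+1].
have [N [l [l0 /ffunP Fl]]] := pigeonhole_eventually F.
exists N, l; split=> //; apply/polyP => i.
have [ir|ri] := ltnP i r; last by rewrite !nth_default // (leq_trans (gr _)).
have := Fl (Ordinal ir); rewrite !ffunE /= => /(congr1 val) /=.
have inc (u : int) : `|u| < c%:Z -> (absz (u + c%:Z)%R < (c + c).+1)%N by lia.
rewrite !inordK ?inc // => E; apply: (mulfI D0).
rewrite -(floorK (Dint N i)) -(floorK (Dint (N + l)%N i)); congr (_%:~R).
have abs_inj (u w : int) : `|u| < c%:Z -> `|w| < c%:Z ->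
    absz (u + c%:Z)%R = absz (w + c%:Z)%R -> u = w by lia.
exact: abs_inj E.
Qed.

(** [M] is not assumed to have coefficients in Z[1/p], so division by it may create denominators; a
    common denominator of the X^i mod [M], i < n, works for all [f] by linearity. *)
Lemma over_zinvp_modp (M : {poly rat}) (n : nat) :
  exists2 q : rat, q != 0 & forall f : {poly rat}, (size f <= n)%N ->
    over_zinvp p f -> over_zinvp p (q *: (f %% M)).
Proof.
have [q q0 qP] : exists2 q : int, q != 0 &
    forall i, (i < n)%N -> over_zinvp p (q%:~R *: ('X^i %% M)).
  elim: n => [|n [q q0 qP]]; first by exists 1.
  have [h [a a0 hE]] := rat_poly_scale ('X^n %% M).
  exists (a * q) => [|i]; first by rewrite mulf_neq0.
  rewrite ltnS leq_eqVlt => /predU1P[->|/qP iP] j; rewrite coefZ rmorphM /=.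
    rewrite hE coefZ coef_map /= mulrAC mulVKf ?intr_eq0 // -rmorphM.
    exact/zinvp_int/intr_int.
  rewrite -mulrA; apply: zinvpM; first exact/zinvp_int/intr_int.
  by have := iP j; rewrite coefZ.
exists q%:~R => [|f fn fz j]; first by rewrite intr_eq0.
have -> : f %% M = \sum_(i < n) f`_i *: ('X^i %% M).
  have fE : f = \sum_(i < n) f`_i *: 'X^i.
    rewrite -poly_def; apply/polyP => i; rewrite coef_poly.
    by case: ltnP => // ni; rewrite nth_default // (leq_trans fn).
  rewrite {1}fE (big_morph _ (modpD M) (mod0p M)).
  by apply: eq_bigr => i _; rewrite modpZl.
rewrite coefZ coef_sum mulr_sumr; apply: zinvp_sum => i _.
rewrite coefZ mulrCA; apply: zinvpM => //.
by have := qP i (ltn_ord i) j; rewrite coefZ.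
Qed.

End ZInvP.

Lemma expr_unbounded (R : archiRealFieldType) (c e : R) : 1 < c -> 0 < e ->
  exists n : nat, 1 < c ^+ n * e.
Proof.
move=> c1 e0; have d0 : 0 < (c - 1) * e by rewrite mulr_gt0 ?subr_gt0.
exists (Num.bound ((c - 1) * e)^-1); set n := Num.bound _.
have bernoulli k : k%:R * (c - 1) <= c ^+ k.
  suff : 1 + k%:R * (c - 1) <= c ^+ k by apply: le_trans; rewrite lerDr.
  elim: k => [|k IH]; first by rewrite mul0r addr0.
  rewrite exprS; apply: le_trans (_ : c * (1 + k%:R * (c - 1)) <= _).
    have : 0 <= k%:R * (c - 1) ^+ 2 by rewrite mulr_ge0 ?sqr_ge0.
    by rewrite -natr1; nra.
  by rewrite ler_pM2l // (lt_trans ltr01).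
apply: lt_le_trans (_ : n%:R * ((c - 1) * e) <= _); last first.
  by rewrite mulrA ler_pM2r.
by rewrite -ltr_pdivrMr // div1r archi_boundP // invr_ge0 ltW.
Qed.

(* Lifts the T-orbit of f(beta) to Q[X]. Subtracting a multiple of the monic  *)
(* polynomial m keeps the degree below that of m (the coefficient of index    *)
(* deg m - 1 is the one pushed up by the shift) without enlarging the         *)
(* denominators away from p.                                                  *)
Section ReducedOrbit.

Variables (m f : {poly rat}) (d : nat -> rat).

Fixpoint reduced_orbit (k : nat) : {poly rat} :=
  if k is k'.+1 then
    let g := reduced_orbit k' in 'X * g - (d k')%:P - g`_(size m).-2 *: m
  else f.

Hypotheses (m_monic : m \is monic) (m_gt1 : (1 < size m)%N).
Hypothesis f_small : (size f < size m)%N.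

Lemma size_reduced_orbit k : (size (reduced_orbit k) < size m)%N.
Proof.
elim: k => // k IH; rewrite /= -(ltn_predK m_gt1) ltnS.
move: (reduced_orbit k) IH => g IH; apply/leq_sizeP => i mi.
have i0 : (0 < i)%N by apply: leq_trans mi; rewrite -subn1 subn_gt0.
rewrite !coefB coefXM coefC coefZ !gtn_eqF //= subr0.
move: mi; rewrite leq_eqVlt => /predU1P[<-|mi].
  by rewrite -[m`_(size m).-1]/(lead_coef m) (monicP m_monic) mulr1 subrr.
have mi' : (size m <= i)%N by rewrite -(ltn_predK m_gt1).
rewrite [m`_i]nth_default // mulr0 subr0 nth_default //.
by rewrite -ltnS prednK // (leq_trans IH).
Qed.

(** The subtracted multiple of [m] vanishes at [z], so every conjugate obeys the recurrence that T
    satisfies at beta. *)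
Lemma horner_reduced_orbit (K : fieldType) (phi : {rmorphism rat -> K}) z k :
  root (map_poly phi m) z ->
  (map_poly phi (reduced_orbit k.+1)).[z] =
    z * (map_poly phi (reduced_orbit k)).[z] + phi (- d k).
Proof.
move=> /eqP mz; rewrite /= !rmorphB rmorphM /= map_polyX map_polyC map_polyZ /=.
by rewrite !hornerE mz mulr0 subr0 rmorphN.
Qed.

Lemma over_zinvp_reduced_orbit p (p_pr : prime p) q :
  over_zinvp p m -> over_zinvp p (q *: f) -> (forall k, zinvp p (q * d k)) ->
  forall k, over_zinvp p (q *: reduced_orbit k).
Proof.
move=> mz fz dz; elim=> [//|k IH] i /=.
rewrite coefZ !coefB coefXM coefC coefZ !mulrBr.
apply: (zinvpD p_pr); last first.
  apply: (zinvpN p_pr); rewrite mulrA; apply: (zinvpM p_pr); last exact: mz.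
  by have := IH (size m).-2; rewrite coefZ.
apply: (zinvpD p_pr); last first.
  apply: (zinvpN p_pr); case: eqP => // _.
  by rewrite mulr0; apply: (zinvp_int p_pr).
by case: eqP => _; [rewrite mulr0; apply: (zinvp_int p_pr)|rewrite -coefZ].
Qed.

End ReducedOrbit.

(** * Dynamics of the beta-map; periodic points lie in Q(beta) *)

Section BetaMap.

Variables (p : nat) (p_pr : prime p) (b : padic p_pr).
Local Notation emb := (@padic_of_rat _ p_pr).
Local Notation T := (beta_map b).

Lemma padic_normX k : padic_norm (b ^+ k) = padic_norm b ^+ k.
Proof.
elim: k => [|k IH]; last by rewrite !exprS padic_normM IH.
by rewrite !expr0 -(rmorph1 emb) padic_norm_rat ratpnorm1.
Qed.

Lemma zinvp_fracpart (x : padic p_pr) : zinvp p (padic_fracpart x).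
Proof.
apply: (zinvp_sum p_pr) => j _; apply: (zinvpM p_pr).
  by apply: (zinvp_int p_pr); rewrite rpred_nat.
by exists 1; eexists; rewrite mul1r.
Qed.

Lemma fracpart_norm (x : padic p_pr) :
  ratpnorm p (padic_fracpart x) <= Num.max (padic_norm x) 1.
Proof.
rewrite -(padic_norm_rat p_pr).
have -> : emb (padic_fracpart x) = x + - padic_intpart x.
  by rewrite padic_intpartE opprB addrC subrK.
apply: le_trans (padic_normD _ _) _; rewrite padic_normN.
by rewrite ge_max !le_max lexx padic_intpart_norm orbT.
Qed.

Lemma beta_mapE x : T x = b * x + emb (- padic_fracpart (b * x)).
Proof. by rewrite /beta_map padic_intpartE rmorphN. Qed.

Lemma iter_beta_map_norm k x : padic_norm x <= 1 -> padic_norm (iter k T x) <= 1.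
Proof. by case: k => // k _; rewrite iterS padic_intpart_norm. Qed.

Lemma iter_beta_map_horner k x : exists r : {poly rat},
  iter k T x = b ^+ k * x - (map_poly emb r).[b].
Proof.
elim: k => [|k [r IH]]; first by exists 0; rewrite rmorph0 horner0 mul1r subr0.
exists (r * 'X + (padic_fracpart (b * iter k T x))%:P).
rewrite iterS beta_mapE {1}IH rmorphD rmorphM /= map_polyX map_polyC hornerMXaddC.
rewrite exprS rmorphN /=; set u := _.[b]; set w := emb _; ring.
Qed.

Hypothesis b_gt1 : 1 < padic_norm b.

Lemma beta_expansion_inj x y : padic_norm x <= 1 -> padic_norm y <= 1 ->
  (forall k, padic_fracpart (b * iter k T x) = padic_fracpart (b * iter k T y)) ->
  x = y.
Proof.
move=> x1 y1 dxy; apply/eqP; rewrite -subr_eq0 -padic_norm_eq0.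
apply: contraT => xy.
have diffE k : iter k T x - iter k T y = b ^+ k * (x - y).
  elim: k => [|k IH]; first by rewrite mul1r.
  rewrite !iterS !beta_mapE dxy exprS -mulrA -IH.
  by rewrite mulrBr opprD addrACA subrr addr0.
have [|k] := @expr_unbounded rat _ (padic_norm (x - y)) b_gt1.
  by rewrite lt_def xy padic_norm_ge0.
rewrite -padic_normX -padic_normM -diffE ltNge => /negP[].
apply: le_trans (padic_normD _ _) _; rewrite padic_normN ge_max.
by rewrite !iter_beta_map_norm.
Qed.

Lemma expr_padic_neq1 l : (0 < l)%N -> b ^+ l != 1.
Proof.
move=> l0; apply: contraTneq b_gt1 => bl; rewrite -leNgt.
have := padic_normX l; rewrite bl -(rmorph1 emb) padic_norm_rat ratpnorm1 //.
move=> /esym/eqP; rewrite pexpr_eq1 // ?padic_norm_ge0 //.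
by move=> /eqP ->.
Qed.

Lemma Per_sub_rat_adjoin a : Per b a -> rat_adjoin b a.
Proof.
move=> [a1 [N [l [l0 per]]]].
have x_per : iter (l + N)%N T a = iter N T a.
  apply: beta_expansion_inj; try exact: iter_beta_map_norm.
  (* The digit of index k + 1 is read off the k-th iterate, so index [(k + N).+1] exceeds [N] and
     periodicity applies. *)
  move=> k; rewrite -!iterD; have := per (k + N).+1; rewrite ltnS leq_addl.
  by rewrite /beta_expansion addSn /= (addnC l) addnA => ->.
have [r rE] := iter_beta_map_horner N a.
have [s sE] := iter_beta_map_horner l (iter N T a).
have b0 : b != 0 by rewrite -padic_norm_eq0 gt_eqF // (lt_trans ltr01).
have bl : b ^+ l - 1 != 0 by rewrite subr_eq0 expr_padic_neq1.
(* With y = b^N a - r(b) the periodic point, y = b^l y - s(b) gives (b^l - 1) (b^N a - r(b)) = s(b),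
   which is solved for a. *)
exists (s + r * ('X^l - 1)), ('X^N * ('X^l - 1)).
have gE : (map_poly emb ('X^N * ('X^l - 1))).[b] = b ^+ N * (b ^+ l - 1).
  by rewrite rmorphM rmorphB rmorph1 /= !map_polyXn !hornerE.
have den0 : b ^+ N * (b ^+ l - 1) != 0 by rewrite mulf_neq0 ?expf_neq0.
have fE : (map_poly emb (s + r * ('X^l - 1))).[b] =
    (map_poly emb s).[b] + (map_poly emb r).[b] * (b ^+ l - 1).
  by rewrite rmorphD rmorphM rmorphB rmorph1 /= !map_polyXn !hornerE.
rewrite gE fE; split=> //; rewrite -[LHS](mulfK den0); congr (_ / _).
move: sE; rewrite -iterD x_per rE => /esym/eqP.
move: (map_poly emb r).[b] (map_poly emb s).[b] (b ^+ N) (b ^+ l) => u w x y.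
rewrite -subr_eq0 => /eqP sE; apply/eqP; rewrite -subr_eq0 -sE; apply/eqP; ring.
Qed.

End BetaMap.

(** * Bounds at the archimedean conjugates *)

Lemma rat_bounded_from_real (R : realType) (u : nat -> nat -> rat) (C : R) :
  (forall k i, ratr (u k i) <= C) -> exists B : rat, forall k i, u k i <= B.
Proof.
move=> uC; exists (Num.bound `|C|)%:R => k i.
rewrite -(ler_rat R) ratr_nat; apply: le_trans (uC k i) _.
by rewrite ltW // (le_lt_trans (ler_norm C)) // archi_boundP.
Qed.

Lemma normc_absolute_value (R : rcfType) :
  absolute_value (@ComplexField.Normc.normc R).
Proof.
split; first exact: ComplexField.Normc.normc0.
- by case=> x y; exact: sqrtr_ge0.
- exact: ComplexField.Normc.normcM.
- move=> [a b] [c d]; have := ler_normD (a +i* b)%C (c +i* d)%C.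
  by rewrite !normc_def -rmorphD lecR.
Qed.

Lemma normc_ratr (R : rcfType) (a : rat) :
  ComplexField.Normc.normc (ratr a : R[i]) = ratr `|a|.
Proof.
have /eqP : `|ratr a : R[i]| = ratr `|a| by rewrite ratr_norm.
have -> : ratr `|a| = (ratr `|a|)%:C%C :> R[i] by rewrite fmorph_rat.
by rewrite normc_def => /eqP/complexI <-; case: (ratr a).
Qed.

(** D / (1 - c) is the fixed point of t -> c t + D; any bound at or above it is preserved by the
    recurrence. *)
Lemma affine_contraction_bounded (R : realFieldType) (u : nat -> R) (c D : R) :
  0 <= c < 1 -> (forall k, u k.+1 <= c * u k + D) ->
  forall k, u k <= Num.max (u 0) (D / (1 - c)).
Proof.
move=> /andP[c0 c1] uS; set B := Num.max _ _.
have d0 : 0 < 1 - c by rewrite subr_gt0.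
have DB : c * B + D <= B.
  have : D / (1 - c) <= B by rewrite le_max lexx orbT.
  by rewrite ler_pdivrMr // => H; lra.
elim=> [|k IH]; first by rewrite le_max lexx.
by apply: le_trans (uS k) (le_trans _ DB); rewrite lerD2r ler_wpM2l.
Qed.

Lemma archimedean_orbit_coef_bounded (R : realType) (m M f : {poly rat})
    (d : nat -> rat) :
  separable_poly M -> M %| m -> (forall k, 0 <= d k < 1) ->
  (forall z : R[i], root (map_poly ratr m) z -> `|z| < 1) ->
  exists C : rat, forall k i, `|(reduced_orbit m f d k %% M)`_i| <= C.
Proof.
move=> sepM Mm d01 mz.
pose v := @ComplexField.Normc.normc R.
pose ev k (z : R[i]) := (map_poly ratr (reduced_orbit m f d k)).[z].
have v_abs : absolute_value v := normc_absolute_value R.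
have [v0 v_ge0 vM vD] := v_abs.
have M0 := separable_poly_neq0 sepM.
have [C CP] := coef_bounded_roots [the {rmorphism rat -> R[i]} of ratr]
  (fun z => Num.max (v (ev 0%N z)) (1 / (1 - v z))) v_abs sepM.
apply: (@rat_bounded_from_real _ _ C) => k i.
rewrite -normc_ratr; apply: CP => [|z Mz]; first by rewrite ltn_modp.
have mz0 : root (map_poly ratr m) z.
  by move: Mm => /dvdpP[h ->]; rewrite rmorphM /= rootM Mz orbT.
have vz : v z < 1.
  have := mz _ mz0; rewrite normc_def -(rmorph1 (real_complex R)) ltcR.
  by rewrite /v; case: (z).
(* Reduction modulo [M] does not change values at roots of [M], so the unreduced recurrence can be
   used there. *)
have -> : (map_poly ratr (reduced_orbit m f d k %% M)).[z] = ev k z.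
  rewrite /ev {2}(divp_eq (reduced_orbit m f d k) M) rmorphD rmorphM /=.
  by rewrite hornerD hornerM (eqP Mz) mulr0 add0r.
apply: (affine_contraction_bounded (u := fun k => v (ev k z))) => [|j].
  by rewrite v_ge0.
rewrite /ev horner_reduced_orbit //; apply: le_trans (vD _ _) _.
rewrite vM lerD2l /= [leLHS]normc_ratr normrN -(rmorph1 (@ratr R)) ler_rat.
by have /andP[d0 d1] := d01 j; rewrite ger0_norm // ltW.
Qed.

(** * Bounds at the p-adic conjugates, and the converse inclusion *)

Section NonArchimedean.

Variables (R : realType) (p : nat) (p_pr : prime p) (L : closedFieldType).
Variables (iota : {rmorphism padic p_pr -> L}) (absL : L -> R).
Hypothesis L_closure : is_padic_closure iota absL.
Local Notation emb := (@padic_of_rat _ p_pr).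

Lemma padic_closure_absolute_value : absolute_value absL.
Proof.
have [_ [v_ge0 v0 vM vD _]] := L_closure.
split=> // [|x y]; first exact/v0.
apply: le_trans (vD x y) _.
by rewrite ge_max lerDl lerDr !v_ge0.
Qed.

Lemma nonarchimedean_orbit_coef_bounded (m M f : {poly rat}) (d : nat -> rat)
    (b : padic p_pr) (s : seq L) (D : rat) :
  separable_poly M -> M %| m ->
  map_poly iota (map_poly emb m) = \prod_(z <- iota b :: s) ('X - z%:P) ->
  (forall z, z \in s -> absL z <= 1) ->
  (forall k, ratpnorm p (d k) <= D) ->
  (forall k, padic_norm (map_poly emb (reduced_orbit m f d k)).[b] <= 1) ->
  exists C : rat, forall k i, ratpnorm p (reduced_orbit m f d k %% M)`_i <= C.
Proof.
move=> sepM Mm mE s1 dD b1.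
have v_abs := padic_closure_absolute_value.
have [_ [v_ge0 _ vM vD v_iota]] := L_closure.
pose phi : {rmorphism rat -> L} := iota \o emb.
have v_phi a : absL (phi a) = ratr (ratpnorm p a).
  by rewrite /= v_iota padic_norm_rat.
have map_phi g : map_poly phi g = map_poly iota (map_poly emb g).
  by rewrite -map_poly_comp.
pose ev k (z : L) := (map_poly phi (reduced_orbit m f d k)).[z].
have M0 := separable_poly_neq0 sepM.
have [C CP] := coef_bounded_roots phi
  (fun z => Num.max 1 (Num.max (absL (ev 0%N z)) (ratr D))) v_abs sepM.
apply: (@rat_bounded_from_real _ _ C) => k i.
rewrite -v_phi; apply: CP => [|z Mz]; first by rewrite ltn_modp.
have mz : root (map_poly phi m) z.
  by move: Mm => /dvdpP[h ->]; rewrite rmorphM /= rootM Mz orbT.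
have -> : (map_poly phi (reduced_orbit m f d k %% M)).[z] = ev k z.
  rewrite /ev {2}(divp_eq (reduced_orbit m f d k) M) rmorphD rmorphM /=.
  by rewrite hornerD hornerM (eqP Mz) mulr0 add0r.
(* At beta there is expansion, and only the hypothesis that the orbit stays in Z_p gives a bound. At
   the other roots |z|_p <= 1 is no strict contraction, but the ultrametric inequality keeps the
   maximum of the initial value and the digits. *)
have := mz; rewrite map_phi mE root_prod_XsubC inE => /predU1P[->|/s1 z1].
  by rewrite /ev map_phi horner_map v_iota le_max -(rmorph1 (@ratr R)) ler_rat b1.
rewrite le_max; apply/orP; right; elim: k => [|k IH].
  by rewrite le_max lexx.
rewrite /ev horner_reduced_orbit //; apply: le_trans (vD _ _) _.
rewrite ge_max v_phi ratpnormN vM; apply/andP; split.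
  by apply: le_trans IH; rewrite ler_piMl.
by rewrite le_max ler_rat dD orbT.
Qed.

Lemma rat_adjoin_sub_Per (beta a : padic p_pr) :
  pisot_chabauty iota absL beta -> rat_adjoin beta a -> padic_norm a <= 1 ->
  Per beta a.
Proof.
move=> beta_PC [f0 [g [gb aE]]] a1.
have [m [[m_monic [mz m0 _ _] mbeta] beta_gt1 [s [mE s1]] m_arch]] := beta_PC.
have [M [M_irr Mbeta]] := root_irreducible_poly m0 mbeta.
have sepM := irreducible_poly_separable M_irr.
have Mm := irreducible_root_dvd M_irr Mbeta mbeta.
have [u ug] := root_inverse M_irr Mbeta gb.
pose f := (f0 * u) %% m.
have m_gt1 : (1 < size m)%N.
  by rewrite -(size_map_poly emb) (root_size_gt1 _ mbeta) // map_poly_eq0.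
have f_small : (size f < size m)%N by rewrite ltn_modp.
have fb : (map_poly emb f).[beta] = a.
  have : (map_poly emb (f0 * u)).[beta] = a.
    rewrite aE rmorphM /= hornerM; apply: (canRL (mulfK gb)).
    by rewrite -mulrA ug mulr1.
  rewrite (divp_eq (f0 * u) m) rmorphD rmorphM /= hornerD hornerM.
  by rewrite (eqP mbeta) mulr0 add0r.
pose d k := padic_fracpart (beta * iter k (beta_map beta) a).
have a_int k : padic_norm (iter k (beta_map beta) a) <= 1.
  exact: iter_beta_map_norm.
pose G := reduced_orbit m f d.
have Gb k : (map_poly emb (G k)).[beta] = iter k (beta_map beta) a.
  elim: k => [|k IH]; first exact: fb.
  by rewrite (horner_reduced_orbit _ _ _ mbeta) IH iterS beta_mapE.
have [C1 C1P] := archimedean_orbit_coef_bounded f sepM Mm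
  (fun k => padic_fracpart_bounds _ : 0 <= d k < 1) m_arch.
have dD k : ratpnorm p (d k) <= Num.max (padic_norm beta) 1.
  apply: le_trans (fracpart_norm _) _; rewrite ge_max !le_max lexx orbT andbT.
  by rewrite padic_normM ler_piMr ?padic_norm_ge0.
have [C2 C2P] := nonarchimedean_orbit_coef_bounded sepM Mm mE s1 dD
  (fun k => (eq_ind_r (fun x => padic_norm x <= 1) (a_int k) (Gb k))).
(* [q] clears the denominators of [f], hence of the whole lifted orbit up to powers of p; [r] below
   pays for the reduction modulo [M]. *)
have [h [q q0 fE]] := rat_poly_scale f.
have Gz : forall k, over_zinvp p (q%:~R *: G k).
  apply: over_zinvp_reduced_orbit => // [i|k].
    rewrite fE scalerA mulfV ?intr_eq0 // scale1r coef_map.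
    exact/(zinvp_int p_pr)/intr_int.
  apply: (zinvpM p_pr); last exact: zinvp_fracpart.
  exact/(zinvp_int p_pr)/intr_int.
have [r r0 rP] := over_zinvp_modp p_pr M (size m).
have [|||||N [l [l0 Nl]]] := @zinvp_poly_recurrent _ p_pr (r * q%:~R) C2 C1
    (size M) (fun k => G k %% M).
- by rewrite mulf_neq0 ?intr_eq0.
- by move=> k; rewrite ltnW // ltn_modp irredp_neq0.
- move=> k; rewrite -scalerA -modpZl; apply: rP => //.
  by rewrite size_scale ?intr_eq0 // ltnW // size_reduced_orbit.
- exact: C2P.
- exact: C1P.
have GMb k : (map_poly emb (G k %% M)).[beta] = iter k (beta_map beta) a.
  rewrite -Gb {2}(divp_eq (G k) M) rmorphD rmorphM /= hornerD hornerM.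
  by rewrite (eqP Mbeta) mulr0 add0r.
have iterNl : iter (N + l) (beta_map beta) a = iter N (beta_map beta) a.
  by rewrite -!GMb Nl.
split=> //; exists N, l; split=> // -[//|k]; rewrite ltnS => Nk.
rewrite /beta_expansion addSn /= -{1}(subnK Nk) -addnA iterD iterNl.
by rewrite -iterD subnK.
Qed.

End NonArchimedean.

Theorem theorem4p1 (R : realType) (p : nat) (p_pr : prime p)
    (L : closedFieldType) (iota : {rmorphism padic p_pr -> L})
    (absL : L -> R) (L_closure : is_padic_closure iota absL)
    (beta : padic p_pr) (beta_PC : pisot_chabauty iota absL beta) :
  Per beta = (rat_adjoin beta `&` padic_int p_pr)%classic.
Proof.
have [_ [_ beta_gt1 _ _]] := beta_PC.
apply/seteqP; split=> [a aP|a [aQ a1]].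
  by split; [exact: Per_sub_rat_adjoin aP|case: aP].
exact (rat_adjoin_sub_Per L_closure beta_PC aQ a1).
Qed.
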